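(* For all integers $m\geq 2$ and $n\geq 3$, the dumbbell graph $DB(W_{m,n})$ is not $D$-integral; that is, there are no $D$-integral dumbbell graphs.
   Context: All graphs are finite and simple. $\overline{K_m}$ is the edgeless graph on $m$ vertices and $C_n$ the cycle on $n$ vertices; the join $G_1\nabla G_2$ is obtained from the disjoint union of $G_1$ and $G_2$ by adding all edges between a vertex of $G_1$ and a vertex of $G_2$. For $m\geq 2$, $n\geq 3$, the generalized wheel graph is $W_{m,n}=\overline{K_m}\nabla C_n$. The dumbbell graph $DB(W_{m,n})$ is obtained from two disjoint copies of $W_{m,n}$ by joining each of the $m$ vertices of the $\overline{K_m}$ part of one copy by an edge to the corresponding vertex of the $\overline{K_m}$ part of the other copy (a perfect matching between the two $\overline{K_m}$ parts). The distance matrix $D(G)$ of a connected graph $G$ has as $(i,j)$-entry the length of a shortest path between $v_i$ and $v_j$. A graph $G$ is $D$-integral if all eigenvalues of $D(G)$ are integers. *)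

(* Defs.v *)
From HB Require Import structures.
From mathcomp Require Import all_boot all_order all_algebra all_field.
Set Implicit Arguments.
Unset Strict Implicit.
Unset Printing Implicit Defensive.
Import Order.TTheory GRing.Theory Num.Theory.

Record sgraph := SGraph {
  vertex :> finType;
  adj : rel vertex;
  adj_sym : symmetric adj;
  adj_irr : irreflexive adj
}.

Definition edgeless_adj (m : nat) : rel 'I_m := fun _ _ => false.

Lemma edgeless_sym m : symmetric (@edgeless_adj m). Proof. by []. Qed.
Lemma edgeless_irr m : irreflexive (@edgeless_adj m). Proof. by []. Qed.

Definition edgeless (m : nat) : sgraph :=
  SGraph (@edgeless_sym m) (@edgeless_irr m).

(* The cycle C_n when n >= 3; the condition [i != j] only matters for n = 1. *)
Definition cycle_adj (n : nat) : rel 'I_n :=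
  fun i j => (i != j) && ((j == i.+1 %% n :> nat) || (i == j.+1 %% n :> nat)).

Lemma cycle_sym n : symmetric (@cycle_adj n).
Proof. by move=> i j; rewrite /cycle_adj eq_sym orbC. Qed.
Lemma cycle_irr n : irreflexive (@cycle_adj n).
Proof. by move=> i; rewrite /cycle_adj eqxx. Qed.

Definition cycle_graph (n : nat) : sgraph :=
  SGraph (@cycle_sym n) (@cycle_irr n).

Definition join_adj (G1 G2 : sgraph) : rel (G1 + G2)%type :=
  fun x y => match x, y with
             | inl u, inl v => adj u v
             | inr u, inr v => adj u v
             | _, _ => true
             end.

Lemma join_sym G1 G2 : symmetric (@join_adj G1 G2).
Proof. by case=> u [] v //=; rewrite adj_sym. Qed.
Lemma join_irr G1 G2 : irreflexive (@join_adj G1 G2).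
Proof. by case=> u /=; rewrite adj_irr. Qed.

Definition join (G1 G2 : sgraph) : sgraph :=
  SGraph (@join_sym G1 G2) (@join_irr G1 G2).

Definition gen_wheel (m n : nat) : sgraph := join (edgeless m) (cycle_graph n).

(* The Boolean selects one of the two copies of the wheel. *)
Definition dumbbell_adj (m n : nat) : rel (bool * gen_wheel m n)%type :=
  fun x y =>
    if x.1 == y.1 then adj x.2 y.2
    else match x.2, y.2 with
         | inl i, inl j => i == j
         | _, _ => false
         end.

Lemma dumbbell_sym m n : symmetric (@dumbbell_adj m n).
Proof.
move=> [b x] [c y]; rewrite /dumbbell_adj /= eq_sym; case: ifP => _.
  exact: join_sym.
by case: x y => i [] j //=; rewrite eq_sym.
Qed.
Lemma dumbbell_irr m n : irreflexive (@dumbbell_adj m n).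
Proof. by move=> [b x]; rewrite /dumbbell_adj /= eqxx; exact: join_irr. Qed.

Definition dumbbell (m n : nat) : sgraph :=
  SGraph (@dumbbell_sym m n) (@dumbbell_irr m n).

Definition has_path (G : sgraph) (x y : G) (k : nat) : bool :=
  [exists p : k.-tuple G,
     [&& path (@adj G) x p, uniq (x :: p) & last x p == y]].

(* The least length of a path from x to y: [find] returns the first index k
   with [has_path x y k], and a path has at most #|G| - 1 edges. The value is
   #|G| when x and y lie in different components. *)
Definition dist (G : sgraph) (x y : G) : nat :=
  find (has_path x y) (iota 0 #|G|).

Local Open Scope ring_scope.

Definition distance_matrix (G : sgraph) : 'M[algC]_#|G| :=
  \matrix_(i, j) (dist (enum_val i) (enum_val j))%:R.

(* Every complex eigenvalue of this integer matrix is algebraic, so ranging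
   over algC loses none of them. *)
Definition D_integral (G : sgraph) : Prop :=
  forall a : algC, eigenvalue (distance_matrix G) a -> a \in Num.int.

(* Main.v *)
(**
  In the dumbbell graph, vectors of the form s(copy) * (a on the edgeless part,
  g on the cycle part) with s = 1 or s = (-1)^copy span invariant subspaces of
  the distance matrix.
  - Taking a = 0 and g(c) = z^c with z a primitive n-th root of unity gives the
    eigenvalue -2 - z - 1/z, whose integrality forces n = 3, 4 or 6.
  - Constant g with s = (-1)^copy gives the roots of x^2 + (m+n+4)x + 4m; for
    each such n, an integer root makes -x-4 a divisor of 12, 16 or 24, so only
    a few values of m remain.
  - Constant g with s = 1 gives the roots of (x-5m+4)(x-5n+4) = 9mn, whose
    discriminant 25(m-n)^2 + 36mn is not a square for any remaining (m, n).
*)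
Require Import Defs.
From mathcomp Require Import all_boot all_order all_algebra all_field.
From mathcomp Require Import zify ring.
Set Implicit Arguments.
Unset Strict Implicit.
Unset Printing Implicit Defensive.
Import Order.TTheory GRing.Theory Num.Theory.

(** * Distances in the dumbbell graph *)

Lemma has_path0 (G : sgraph) (x y : G) : has_path x y 0 = (x == y).
Proof.
apply/existsP/eqP => [[p]|->]; first by rewrite tuple0 /= => /eqP.
by exists [tuple]; rewrite /= eqxx.
Qed.

Lemma has_path1 (G : sgraph) (x y : G) : has_path x y 1 = adj x y.
Proof.
apply/existsP/idP => [[p]|xy].
  by case/tupleP: p => u p; rewrite tuple0 /= => /and3P[/andP[xu _] _ /eqP <-].
exists [tuple y]; rewrite /= xy eqxx !andbT inE.
by apply: contraTneq xy => ->; rewrite adj_irr.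
Qed.

Lemma has_path2P (G : sgraph) (x y : G) :
  reflect (x != y /\ exists2 u, adj x u & adj u y) (has_path x y 2).
Proof.
apply: (iffP existsP) => [[p]|[xy [u xu uy]]].
  case/tupleP: p => u p; case/tupleP: p => v p; rewrite tuple0 /=.
  case/and3P=> /and3P[xu uv _] /and3P[]; rewrite !inE negb_or => /andP[_ xv] _ _.
  by move/eqP <-; split => //; exists u.
exists [tuple u; y]; rewrite /= xu uy eqxx !inE negb_or xy !andbT /=.
apply/andP; split.
  by apply: contraTneq xu => ->; rewrite adj_irr.
by apply: contraTneq uy => ->; rewrite adj_irr.
Qed.

Lemma dist_eq (G : sgraph) (x y : G) (k : nat) :
    k < #|G| -> has_path x y k ->
    (forall j, j < k -> ~~ has_path x y j) ->
  dist x y = k.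
Proof.
move=> kG pk lt; rewrite /dist.
have -> : iota 0 #|G| = iota 0 k ++ k :: iota k.+1 (#|G| - k.+1).
  by rewrite -{1}(subnKC kG) addSn -addnS iotaD add0n.
rewrite find_cat size_iota /= pk addn0 ifN //.
by apply/hasPn => j; rewrite mem_iota add0n => /lt.
Qed.

Lemma dist_self (G : sgraph) (x : G) : dist x x = 0.
Proof. by apply: dist_eq; rewrite ?has_path0 //; apply/card_gt0P; exists x. Qed.

Lemma adj_neq (G : sgraph) (x y : G) : adj x y -> x != y.
Proof. by apply: contraTneq => ->; rewrite adj_irr. Qed.

Lemma dist_adj (G : sgraph) (x y : G) : 1 < #|G| -> adj x y -> dist x y = 1.
Proof.
move=> cG xy; apply: dist_eq; rewrite ?has_path1 // => -[] // _.
by rewrite has_path0 adj_neq.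
Qed.

Lemma dist_two (G : sgraph) (x y u : G) : 2 < #|G| ->
  x != y -> ~~ adj x y -> adj x u -> adj u y -> dist x y = 2.
Proof.
move=> cG xy nxy xu uy; apply: dist_eq => //.
  by apply/has_path2P; split; last exists u.
by case=> [|[]] // _; rewrite ?has_path0 ?has_path1.
Qed.

Lemma dist_three (G : sgraph) (x y u v : G) : 3 < #|G| ->
    x != y -> ~~ adj x y -> ~ (exists2 w, adj x w & adj w y) ->
  adj x u -> adj u v -> adj v y -> dist x y = 3.
Proof.
move=> cG xy nxy n2xy xu uv vy; apply: dist_eq => //.
  apply/existsP; exists [tuple u; v; y].
  rewrite /= xu uv vy eqxx !inE !negb_or xy (adj_neq xu) (adj_neq uv) (adj_neq vy) !andbT /=.
  apply/andP; split; first by apply: contraNneq nxy => ->.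
  by apply: contraNneq nxy => <-.
case=> [|[|[]]] // _; rewrite ?has_path0 ?has_path1 //.
by apply/negP => /has_path2P[].
Qed.

(** Booleans count as 0 and 1: on the cycle of one copy the factor [c != d] handles the diagonal and
    [2 - cycle_adj c d] separates neighbours from the rest. *)
Definition dumbbell_dist m n (x y : dumbbell m n) : nat :=
  match x.2, y.2 with
  | inl i, inl j => if x.1 == y.1 then 2 * (i != j) else 1 + 2 * (i != j)
  | inr c, inr d => if x.1 == y.1 then (c != d) * (2 - cycle_adj c d) else 3
  | _, _ => if x.1 == y.1 then 1 else 2
  end.

(** Within a copy, nonadjacent vertices of one part share a neighbour in the other part. Between
    copies every path crosses a matching edge, and any step to or from the ends of that edge costs
    one more. *)
Lemma dist_dumbbell m n (x y : dumbbell m n) :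
  1 < m -> 2 < n -> dist x y = dumbbell_dist x y.
Proof.
move=> m1 n2.
have cG : 3 < #|dumbbell m n|.
  by rewrite card_prod card_bool card_sum !card_ord; lia.
have cG2 := ltnW cG; have cG1 := ltnW cG2.
have D1 := @dist_adj _ x y cG1.
have D2 u := @dist_two _ x y u cG2.
have D3 u v := @dist_three _ x y u v cG.
have c0 : 'I_n by exact: (Ordinal (ltnW (ltnW n2))).
have i0 : 'I_m by exact: (Ordinal (ltnW m1)).
move: x y D1 D2 D3 => [b x] [b' y]; rewrite /dumbbell_dist /=.
have [<-{b'}|bb'] := eqVneq b b'.
  case: x y => [i|c] [j|d] D1 D2 D3.
  - have [ij|ij] := eqVneq i j; first by rewrite ij dist_self.
    apply: (D2 (b, inr c0)); rewrite /= /dumbbell_adj /= ?eqxx //.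
    by apply: contra ij => /eqP[->].
  - by rewrite D1 //= /dumbbell_adj /= eqxx.
  - by rewrite D1 //= /dumbbell_adj /= eqxx.
  - have [cd|cd] := eqVneq c d; first by rewrite cd dist_self.
    rewrite mul1n; case: (boolP (cycle_adj c d)) => acd.
      by rewrite D1 //= /dumbbell_adj /= eqxx.
    apply: (D2 (b, inl i0)); rewrite /= /dumbbell_adj /= ?eqxx //.
    by apply: contra cd => /eqP[->].
case: x y => [i|c] [j|d] D1 D2 D3.
- have [ij|ij] := eqVneq i j.
    by rewrite D1 //= /dumbbell_adj /= (negbTE bb') ij eqxx.
  apply: (D3 (b, inr c0) (b, inl j)); rewrite /= /dumbbell_adj /= ?eqxx ?(negbTE bb') //.
  + by apply: contra bb' => /eqP[->].
  (* A path of length two between the copies uses a matching edge, so its other edge would lie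
     inside an edgeless part. *)
  + case=> -[b1 [k|e]] /=; case: (eqVneq b b1) => //.
      by move=> _ /eqP <-; case: ifP => // _ /eqP ij'; rewrite ij' eqxx in ij.
    by move=> <-; rewrite (negbTE bb').
- apply: (D2 (b', inl i)); rewrite /= /dumbbell_adj /= ?eqxx ?(negbTE bb') //.
  by apply: contra bb' => /eqP[->].
- apply: (D2 (b, inl j)); rewrite /= /dumbbell_adj /= ?eqxx ?(negbTE bb') //.
  by apply: contra bb' => /eqP[->].
- apply: (D3 (b, inl i0) (b', inl i0)); rewrite /= /dumbbell_adj /= ?eqxx ?(negbTE bb') //.
  + by apply: contra bb' => /eqP[->].
  + case=> -[b1 [k|e]] /=; case: (eqVneq b b1) => // <-.
      by rewrite (negbTE bb').
    by rewrite (negbTE bb').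
Qed.

(** For [2 < n] the successor and predecessor of [d] are distinct and differ from [d], so the sum
    never reaches 2. This form makes distances on the cycle linear in indicators. *)
Lemma cycle_adjE n (c d : 'I_n) : 2 < n ->
  cycle_adj c d = (c == ordS d) + (c == ord_pred d) :> nat.
Proof.
move=> n2; rewrite /cycle_adj.
have -> : (d == c.+1 %% n :> nat) = (c == ord_pred d).
  by rewrite -(inj_eq (@ordS_inj n)) ord_predK eq_sym.
have -> : (c == d.+1 %% n :> nat) = (c == ordS d) by [].
have SP : ordS d != ord_pred d.
  apply/eqP => /(congr1 val) /=; have := ltn_ord d; move: (d : nat) => k kn.
  have [e|e] := eqVneq k.+1 n.
    rewrite e modnn; have -> : ((k + n).-1 = n.-2 + n)%N by lia.
    rewrite modnDr modn_small; lia.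
  rewrite (modn_small (m := k.+1)); last by lia.
  case: k e kn => [|k] e kn; first by rewrite add0n modn_small; lia.
  rewrite addSn /= modnDr modn_small; lia.
have Sd : ordS d != d.
  apply/eqP => /(congr1 val) /=; have := ltn_ord d; move: (d : nat) => k kn.
  have [e|e] := eqVneq k.+1 n; first by rewrite e modnn; lia.
  rewrite modn_small; lia.
have Pd : ord_pred d != d by apply: contra Sd => /eqP {1}<-; rewrite ord_predK.
have [->|cS] := eqVneq c (ordS d); first by rewrite Sd (negbTE SP) orbT.
by have [->|cP] := eqVneq c (ord_pred d); rewrite ?Pd //= andbF.
Qed.

Local Open Scope ring_scope.

(** * Eigenvectors of the distance matrix *)

Lemma eigenvalue_distance (G : sgraph) (f : G -> algC) (x0 : G) (a : algC) :
    f x0 != 0 -> (forall y, \sum_x f x * (dist x y)%:R = a * f y) ->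
  eigenvalue (distance_matrix G) a.
Proof.
move=> fx0 fE; apply/eigenvalueP; exists (\row_i f (enum_val i)).
  apply/rowP => j; rewrite !mxE -fE (reindex (@enum_val G G)) /=.
    by apply: eq_bigr => i _; rewrite !mxE.
  by apply: onW_bij; exact: enum_val_bij.
apply: contraNneq fx0 => /rowP/(_ (enum_rank x0)).
by rewrite !mxE enum_rankK => ->.
Qed.

Definition bell_vector m n (s : bool -> algC) (a : algC) (g : 'I_n -> algC)
    (x : dumbbell m n) : algC :=
  s x.1 * match x.2 with inl _ => a | inr c => g c end.

(** Naming the copies relative to [b], the copy of the target vertex, separates distances within a
    copy from distances across. *)
Lemma bell_vector_sum m n s a g (F : dumbbell m n -> algC) b :
  \sum_x bell_vector s a g x * F x =
  s b * (a * (\sum_i F (b, inl i)) + \sum_c g c * F (b, inr c)) +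
  s (~~ b) * (a * (\sum_i F (~~ b, inl i)) + \sum_c g c * F (~~ b, inr c)).
Proof.
have E b1 : \sum_(x : gen_wheel m n) bell_vector s a g (b1, x) * F (b1, x) =
  s b1 * (a * (\sum_i F (b1, inl i)) + \sum_c g c * F (b1, inr c)).
  rewrite big_sumType /= mulrDr mulrA !mulr_sumr; congr (_ + _).
  by apply: eq_bigr => c _; rewrite mulrA.
transitivity (\sum_b1 \sum_(x : gen_wheel m n) bell_vector s a g (b1, x) * F (b1, x)).
  rewrite pair_bigA /=; by apply: eq_bigr => -[].
by rewrite big_bool /= !E; case: b => //=; rewrite addrC.
Qed.

Lemma sum_neq_ord k (j : 'I_k) : \sum_(i < k) (i != j)%:R = k%:R - 1 :> algC.
Proof.
rewrite (bigD1 j) //= eqxx add0r (eq_bigr (fun=> 1)) => [|i ->] //.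
by rewrite sumr_const cardC1 card_ord -[in RHS](prednK (leq_ltn_trans _ (ltn_ord j))) // -natr1 addrK.
Qed.

(** The two systems are the eigenvector equations at an edgeless vertex and at a cycle vertex. An
    edgeless vertex has total distance [2 (m - 1)] to its own part and [1 + 3 (m - 1)] to the
    opposite one; [t] is the eigenvalue of [g] for adjacency in the cycle. *)
Lemma eigenvalue_bell m n s a g (S t x : algC) (y0 : dumbbell m n) :
    (1 < m)%N -> (2 < n)%N ->
    \sum_c g c = S ->
    (forall c, g (ordS c) + g (ord_pred c) = t * g c) ->
    (forall b, s b * (a * (2 * m%:R - 2) + S) +
               s (~~ b) * (a * (3 * m%:R - 2) + 2 * S) = x * (s b * a)) ->
    (forall b c, s b * (a * m%:R + (2 * S - 2 * g c - t * g c)) +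
                 s (~~ b) * (2 * a * m%:R + 3 * S) = x * (s b * g c)) ->
    bell_vector s a g y0 != 0 ->
  eigenvalue (distance_matrix (dumbbell m n)) x.
Proof.
move=> hm hn gS gt eK eC y0n; apply: eigenvalue_distance y0n _ => y.
under eq_bigr do rewrite dist_dumbbell //.
case: y => b [j|d]; rewrite (bell_vector_sum _ _ _ _ b) /dumbbell_dist /= eqxx;
  have -> : (~~ b == b) = false by case: b.
- rewrite /bell_vector /= -eK -gS; congr (_ * (_ * _ + _) + _ * (_ * _ + _)).
  + by under eq_bigr do rewrite natrM; rewrite -mulr_sumr sum_neq_ord; ring.
  + by under eq_bigr do rewrite mulr1.
  + under eq_bigr do rewrite natrD natrM.
    by rewrite big_split /= -mulr_sumr sum_neq_ord sumr_const card_ord; ring.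
  + by rewrite -mulr_suml mulrC.
- rewrite /bell_vector /= -eC !sumr_const !card_ord -gS -mulr_suml.
  rewrite [\sum_(c < n) _](_ : _ = 2 * (\sum_c g c) - 2 * g d - t * g d).
    by ring.
  (* Distance on the cycle is 2, lowered by 2 on the diagonal and by 1 at each of the two
     neighbours. *)
  have E c : g c * ((c != d) * (2 - cycle_adj c d))%:R =
     2 * g c - 2 * (g c * (c == d)%:R) - g c * (c == ordS d)%:R - g c * (c == ord_pred d)%:R.
    have adjE := cycle_adjE c d hn.
    have -> : ((c != d) * (2 - cycle_adj c d))%:R =
       2 - 2 * (c == d)%:R - (cycle_adj c d)%:R :> algC.
      have [->|cd] := eqVneq c d; first by rewrite (cycle_irr d) mul0n mulr1 subrr subr0.
      by case: (cycle_adj c d); rewrite mul1n mulr0 subr0 ?subr0 // -natr1 addrK.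
    by rewrite adjE natrD; ring.
  have P e : \sum_c g c * (c == e)%:R = g e.
    rewrite (bigD1 e) //= eqxx mulr1 big1 ?addr0 // => c /negbTE ->.
    by rewrite mulr0.
  rewrite (eq_bigr _ (fun c _ => E c)) !sumrB -!mulr_sumr !P -gt; ring.
Qed.

(** * Consequences of integrality *)

Lemma root_trace_int_order (n : nat) (z : algC) : n.-primitive_root z ->
  z + z^-1 \in Num.int -> (n %| 4)%N || (n %| 6)%N.
Proof.
move=> pz /intrP[k zk].
have zn1 : `|z| = 1.
  apply/eqP; rewrite -(pexpr_eq1 (prim_order_gt0 pz)) //.
  by rewrite -normrX (prim_expr_order pz) normr1.
have z0 : z != 0 by rewrite -normr_eq0 zn1 oner_eq0.
have k2 : `|k| <= 2.
  rewrite -(ler_int algC) intr_norm -zk (le_trans (ler_normD _ _)) //.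
  by rewrite normfV zn1 invr1.
have zz : z ^+ 2 = k%:~R * z - 1 by rewrite -zk; field.
rewrite !(prim_order_dvd pz).
(* In this order, [zz] yields [z = 1], [z ^+ 6 = 1], [z ^+ 4 = 1], [z ^+ 6 = 1] and [z = -1]. *)
have : k \in [:: 2; 1; 0; -1; -2 : int] by rewrite !inE; lia.
rewrite !inE => /or4P[/eqP kE|/eqP kE|/eqP kE|/orP[]/eqP kE]; move: zz; rewrite kE => zz.
- have /eqP : (z - 1) ^+ 2 = 0 by rewrite sqrrB zz; ring.
  by rewrite sqrf_eq0 subr_eq0 => /eqP ->; rewrite expr1n eqxx.
- by apply/orP; right; apply/eqP; rewrite (exprM z 2 3) zz; ring: zz.
- by apply/orP; left; apply/eqP; rewrite (exprM z 2 2) zz; ring.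
- by apply/orP; right; apply/eqP; rewrite (exprM z 2 3) zz; ring: zz.
- have /eqP : (z + 1) ^+ 2 = 0 by rewrite sqrrD zz; ring.
  rewrite sqrf_eq0 addr_eq0 => /eqP ->.
  by rewrite -signr_odd /= eqxx.
Qed.

(** The powers of [z] sum to zero over the cycle, so all constant distance blocks cancel and only
    the cycle block acts. *)
Lemma dumbbell_integral_cycle (m n : nat) : (1 < m)%N -> (2 < n)%N ->
  D_integral (dumbbell m n) -> n \in [:: 3; 4; 6]%N.
Proof.
move=> hm hn Dint; have n0 : (0 < n)%N by exact: ltnW (ltnW hn).
have [z pz] := C_prim_root_exists n0.
have z0 : z != 0.
  apply/eqP => z0; have := prim_expr_order pz; rewrite z0 expr0n gtn_eqF // => /eqP.
  by rewrite eq_sym oner_eq0.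
have z1 : z != 1.
  apply/eqP => z1; have := prim_order_dvd pz 1; rewrite z1 expr1n eqxx dvdn1.
  by move=> /eqP; lia.
have zmod k : z ^+ (k %% n) = z ^+ k by exact: prim_expr_mod.
have S0 : \sum_(c < n) z ^+ c = 0.
  apply/eqP; have /eqP := subrX1 z n.
  by rewrite (prim_expr_order pz) subrr eq_sym mulf_eq0 subr_eq0 (negbTE z1).
have zpred (c : 'I_n) : z ^+ ord_pred c = z^-1 * z ^+ c.
  have {2}-> : c = ordS (ord_pred c) by rewrite ord_predK.
  by move: (ord_pred c) => d; rewrite zmod exprS mulKf.
have t c : z ^+ (@ordS n c) + z ^+ (ord_pred c) = (z + z^-1) * z ^+ c.
  by rewrite zpred /= zmod exprS mulrDl.
have /Dint : eigenvalue (distance_matrix (dumbbell m n)) (- 2 - (z + z^-1)).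
  apply: (@eigenvalue_bell m n (fun=> 1) 0 (fun c => z ^+ c) 0 (z + z^-1)
    _ (true, inr (Ordinal n0))) => //.
  - by move=> _; ring.
  - by move=> _ c; ring.
  - by rewrite /bell_vector /= mul1r expr0 oner_eq0.
move=> xint; have tint : z + z^-1 \in Num.int.
  have -> : z + z^-1 = - (- 2 - (z + z^-1)) - 2 by ring.
  by rewrite rpredB ?rpredN // rpred_nat.
have /orP[] := root_trace_int_order pz tint => d; have := dvdn_leq _ d.
  by case: n d hn {Dint n0 pz zmod S0 zpred t} => [|[|[|[|[|]]]]] //; lia.
by case: n d hn {Dint n0 pz zmod S0 zpred t} => [|[|[|[|[|[|[|]]]]]]] //; lia.
Qed.

(** With the square isolated, the equation reduces polynomials in [x] to degree at most one. *)
Lemma quadratic_rootC (p q : algC) : exists x, x ^+ 2 = - (p * x) - q.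
Proof.
exists ((sqrtC (p ^+ 2 - 4 * q) - p) / 2).
have := sqrtCK (p ^+ 2 - 4 * q); move: (sqrtC _) => r rE.
have -> : q = (p ^+ 2 - r ^+ 2) / 4 by rewrite rE; field.
by field.
Qed.

Lemma dumbbell_integral_antisym (m n : nat) : (1 < m)%N -> (2 < n)%N ->
  D_integral (dumbbell m n) ->
  exists x : int, x ^+ 2 + (m + n + 4)%:Z * x + 4 * m%:Z = 0.
Proof.
move=> hm hn Dint; have m0 := ltnW hm; have n0 := ltnW (ltnW hn).
have [x xE] := quadratic_rootC (m%:R + n%:R + 4) (4 * m%:R).
have /Dint/intrP[k kE] : eigenvalue (distance_matrix (dumbbell m n)) x.
  (* The equation at an edgeless vertex reads [a (x + m) = - n g], which dictates both entries; the
     equation at a cycle vertex is then the quadratic. *)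
  apply: (@eigenvalue_bell m n (fun b => (-1) ^+ b) (- n%:R) (fun=> x + m%:R)
     (n%:R * (x + m%:R)) 2 _ (false, inl (Ordinal m0))) => //.
  - by rewrite sumr_const card_ord -[LHS]mulr_natl.
  - by move=> c; ring.
  - by case=> /=; rewrite ?expr0 ?expr1; ring.
  - by case=> c /=; rewrite ?expr0 ?expr1; ring: xE.
  - by rewrite /bell_vector /= mul1r oppr_eq0 pnatr_eq0 -lt0n.
exists k; apply: (@intr_inj algC).
by rewrite !(rmorphD, rmorphM, rmorphXn) /= -kE xE; ring.
Qed.

Lemma dumbbell_integral_sym (m n : nat) : (1 < m)%N -> (2 < n)%N ->
  D_integral (dumbbell m n) ->
  exists x : int, (x - 5 * m%:Z + 4) * (x - 5 * n%:Z + 4) = 9 * m%:Z * n%:Z.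
Proof.
move=> hm hn Dint; have m0 := ltnW hm; have n0 := ltnW (ltnW hn).
have [x xE] := quadratic_rootC (8 - 5 * m%:R - 5 * n%:R)
  ((5 * m%:R - 4) * (5 * n%:R - 4) - 9 * m%:R * n%:R).
have /Dint/intrP[k kE] : eigenvalue (distance_matrix (dumbbell m n)) x.
  (* Here the edgeless equation reads [a (x - 5 m + 4) = 3 n g]. *)
  apply: (@eigenvalue_bell m n (fun=> 1) (3 * n%:R) (fun=> x - 5 * m%:R + 4)
     (n%:R * (x - 5 * m%:R + 4)) 2 _ (false, inl (Ordinal m0))) => //.
  - by rewrite sumr_const card_ord -[LHS]mulr_natl.
  - by move=> c; ring.
  - by move=> _; ring.
  - by move=> _ c; ring: xE.
  - by rewrite /bell_vector /= mul1r mulf_neq0 ?pnatr_eq0 -?lt0n.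
exists k; apply: (@intr_inj algC).
by rewrite !(rmorphD, rmorphM, rmorphN) /= -kE; ring: xE.
Qed.

(** * Elimination of the remaining pairs *)

Lemma no_square_between (k d t : int) :
  0 <= k -> k ^+ 2 < d -> d < (k + 1) ^+ 2 -> t ^+ 2 <> d.
Proof.
move=> k0 kd dk tE; move: kd dk; rewrite -tE -(real_normK (num_real t)).
by rewrite !ltr_sqr ?nnegrE ?addr_ge0 //; lia.
Qed.

(** Reduces a factorization over the integers to finitely many linear cases in the cofactor, one per
    divisor and sign. *)
Lemma mulz_eq_divisors (w v : int) (N : nat) : (0 < N)%N -> w * v = N%:Z ->
  exists2 d : nat, d \in divisors N &
    (w = d%:Z /\ d%:Z * v = N%:Z) \/ (w = - d%:Z /\ d%:Z * v = - N%:Z).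
Proof.
move=> N0 wv; exists `|w|%N.
  by rewrite -dvdn_divisors // -[N]absz_nat -wv abszM dvdn_mulr.
have [w0|w0] := leP 0 w; [left|right]; split; rewrite -?wv.
- by rewrite gez0_abs.
- by rewrite gez0_abs.
- by rewrite ltz0_abs ?opprK.
- by rewrite ltz0_abs // mulNr.
Qed.

Local Close Scope ring_scope.

Theorem theorem5 (m n : nat) (hm : 2 <= m) (hn : 3 <= n) :
  ~ D_integral (dumbbell m n).
Proof.
move=> Dint.
have [x xE] := dumbbell_integral_antisym hm hn Dint.
have [y yE] := dumbbell_integral_sym hm hn Dint.
have nE := dumbbell_integral_cycle hm hn Dint.
(* The square of the sum of the factors in [yE] is the square of their difference plus four times
   their product. *)
have yD : ((2 * y - 5 * m%:Z - 5 * n%:Z + 8) ^+ 2 =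
           25 * (m%:Z - n%:Z) ^+ 2 + 36 * m%:Z * n%:Z)%R.
  by rewrite !expr2; lia.
move: nE; rewrite !inE => /or3P[]/eqP nE; subst n.
(* In general [xE] is equivalent to [(x + 4) (x + m + n) = 4 n]. *)
- have wv : ((- x - 4) * (- x - 3 - m%:Z) = 12%:Z)%R by move: xE; rewrite expr2; lia.
  have [d] := mulz_eq_divisors (isT : 0 < 12) wv.
  have -> : divisors 12 = [:: 1; 2; 3; 4; 6; 12] by [].
  rewrite !inE => dN {}wv.
  (* The difference of the two factors is [m + n - 4], so each factorization of [4 n] determines
     [m]; only values with [2 <= m] are kept. *)
  have : m \in [:: 2; 5; 12].
    by move: dN wv; rewrite !inE; do ?[case/orP]; move=> /eqP -> wv; lia.
  rewrite !inE => /or3P[]/eqP mE; subst m.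
  (* In each case the witness is the integer square root of the discriminant; here 225 < 241 <
     256. *)
  + by apply: (@no_square_between (Posz 15) _ _ _ _ _ yD).
  + by apply: (@no_square_between (Posz 25) _ _ _ _ _ yD).
  + by apply: (@no_square_between (Posz 57) _ _ _ _ _ yD).
- have wv : ((- x - 4) * (- x - 4 - m%:Z) = 16%:Z)%R by move: xE; rewrite expr2; lia.
  have [d] := mulz_eq_divisors (isT : 0 < 16) wv.
  have -> : divisors 16 = [:: 1; 2; 4; 8; 16] by [].
  rewrite !inE => dN {}wv.
  have : m \in [:: 6; 15].
    by move: dN wv; rewrite !inE; do ?[case/orP]; move=> /eqP -> wv; lia.
  rewrite !inE => /orP[]/eqP mE; subst m.
  + by apply: (@no_square_between (Posz 31) _ _ _ _ _ yD).
  + by apply: (@no_square_between (Posz 72) _ _ _ _ _ yD).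
- have wv : ((- x - 4) * (- x - 6 - m%:Z) = 24%:Z)%R by move: xE; rewrite expr2; lia.
  have [d] := mulz_eq_divisors (isT : 0 < 24) wv.
  have -> : divisors 24 = [:: 1; 2; 3; 4; 6; 8; 12; 24] by [].
  rewrite !inE => dN {}wv.
  have : m \in [:: 3; 8; 21].
    by move: dN wv; rewrite !inE; do ?[case/orP]; move=> /eqP -> wv; lia.
  rewrite !inE => /or3P[]/eqP mE; subst m.
  + by apply: (@no_square_between (Posz 29) _ _ _ _ _ yD).
  + by apply: (@no_square_between (Posz 42) _ _ _ _ _ yD).
  + by apply: (@no_square_between (Posz 100) _ _ _ _ _ yD).
Qed.
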